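(* Let $H=\{H_\alpha\}_{\alpha\in\pi}$ be a finite dimensional Hopf $\pi$-coalgebra. Then there exists a unique $\pi$-grouplike element $g=(g_\alpha)_{\alpha\in\pi}$ of $H$ such that $(\mathrm{id}_{H_\alpha}\otimes\lambda_\beta)\Delta_{\alpha,\beta}=\lambda_{\alpha\beta}\,g_\alpha$ for any right $\pi$-integral $\lambda=(\lambda_\alpha)_{\alpha\in\pi}$ for $H$ and all $\alpha,\beta\in\pi$.
   Context: Throughout, $\pi$ is a discrete group with neutral element $1$, $\Bbbk$ is a field, $\otimes=\otimes_\Bbbk$, and algebras are associative and unital over $\Bbbk$ (the zero algebra is allowed). A $\pi$-coalgebra is a family $C=\{C_\alpha\}_{\alpha\in\pi}$ of $\Bbbk$-spaces with $\Bbbk$-linear maps $\Delta_{\alpha,\beta}:C_{\alpha\beta}\to C_\alpha\otimes C_\beta$ and $\epsilon:C_1\to\Bbbk$ such that $(\Delta_{\alpha,\beta}\otimes\mathrm{id}_{C_\gamma})\Delta_{\alpha\beta,\gamma}=(\mathrm{id}_{C_\alpha}\otimes\Delta_{\beta,\gamma})\Delta_{\alpha,\beta\gamma}$ and $(\mathrm{id}_{C_\alpha}\otimes\epsilon)\Delta_{\alpha,1}=\mathrm{id}_{C_\alpha}=(\epsilon\otimes\mathrm{id}_{C_\alpha})\Delta_{1,\alpha}$ for all $\alpha,\beta,\gamma\in\pi$. A Hopf $\pi$-coalgebra is a $\pi$-coalgebra $H=(\{H_\alpha\},\Delta,\epsilon)$ with $\Bbbk$-linear maps $S_\alpha:H_\alpha\to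 H_{\alpha^{-1}}$ (the antipode) such that each $H_\alpha$ is an algebra with multiplication $m_\alpha$ and unit $1_\alpha$, the maps $\epsilon$ and all $\Delta_{\alpha,\beta}$ are algebra homomorphisms, and $m_\alpha(S_{\alpha^{-1}}\otimes\mathrm{id}_{H_\alpha})\Delta_{\alpha^{-1},\alpha}=\epsilon 1_\alpha=m_\alpha(\mathrm{id}_{H_\alpha}\otimes S_{\alpha^{-1}})\Delta_{\alpha,\alpha^{-1}}$ for all $\alpha$. $H$ is finite dimensional if every $H_\alpha$ is finite dimensional over $\Bbbk$. A right $\pi$-integral for $H$ is a family $\lambda=(\lambda_\alpha)_{\alpha\in\pi}\in\prod_\alpha H_\alpha^*$ with $(\lambda_\alpha\otimes\mathrm{id}_{H_\beta})\Delta_{\alpha,\beta}=\lambda_{\alpha\beta}\,1_\beta$ for all $\alpha,\beta\in\pi$. A $\pi$-grouplike element of $H$ is a family $g=(g_\alpha)_{\alpha\in\pi}\in\prod_\alpha H_\alpha$ with $\Delta_{\alpha,\beta}(g_{\alpha\beta})=g_\alpha\otimes g_\beta$ for all $\alpha,\beta\in\pi$ and $\epsilon(g_1)=1$. *)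

(* Defs.v *)
From HB Require Import structures.
From mathcomp Require Import all_boot all_order all_algebra.

Set Implicit Arguments.
Unset Strict Implicit.
Unset Printing Implicit Defensive.

Import GRing.Theory.
Local Open Scope ring_scope.

(* MathComp's algType and falgType exclude the zero algebra, and a component
   of a Hopf pi-coalgebra may be zero. The multiplication is presented as a
   bilinear map; the ring structure is then that of a pzRingType (a possibly
   zero ring). *)
Record fdAlgType (K : fieldType) := FdAlgType {
  fdspace : vectType K;
  fdone : fdspace;
  fdmul : {bilinear fdspace -> fdspace -> fdspace};
  fdmulA : associative fdmul;
  fdmul1r : left_id fdone fdmul;
  fdmulr1 : right_id fdone fdmul
}.

Definition fdcarrier (K : fieldType) (A : fdAlgType K) : Type := fdspace A.

HB.instance Definition _ (K : fieldType) (A : fdAlgType K) :=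
  Vector.copy (fdcarrier A) (fdspace A).

Section FdAlgebraRing.
Variables (K : fieldType) (A : fdAlgType K).

Fact fdmulDl : left_distributive (fdmul A) +%R.
Proof. by move=> x y z; rewrite linearDl. Qed.

Fact fdmulDr : right_distributive (fdmul A) +%R.
Proof. by move=> x y z; rewrite linearD. Qed.

HB.instance Definition _ := GRing.Zmodule_isPzRing.Build (fdcarrier A)
  (@fdmulA K A) (@fdmul1r K A) (@fdmulr1 K A) fdmulDl fdmulDr.

End FdAlgebraRing.

Coercion fdvect (K : fieldType) (A : fdAlgType K) : vectType K :=
  fdcarrier A.

Section FdAlgebraTheory.
Variables (K : fieldType) (A : fdAlgType K).

Lemma fdscalerAl (a : K) (x y : A) : a *: (x * y) = (a *: x) * y.
Proof. by rewrite -[RHS]/(fdmul A _ _) linearZl_LR. Qed.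

Lemma fdscalerAr (a : K) (x y : A) : a *: (x * y) = x * (a *: y).
Proof. by rewrite -[RHS]/(fdmul A _ _) linearZ. Qed.

End FdAlgebraTheory.

(* The tensor product of two finite dimensional spaces, realized by the arrays
   of coordinates on the products of basis vectors; [tlift_tens] and
   [tlift_unique] are its universal property. *)
Definition tensor (K : fieldType) (V W : vectType K) : Type :=
  'M[K]_(\dim {:V}, \dim {:W}).

Notation "V \otimes W" := (tensor V W)
  (at level 40, left associativity) : type_scope.

HB.instance Definition _ (K : fieldType) (V W : vectType K) :=
  Vector.copy (tensor V W) 'M[K]_(\dim {:V}, \dim {:W}).

Definition tens (K : fieldType) (V W : vectType K) (v : V) (w : W) :
    V \otimes W :=
  \matrix_(i, j) (coord (vbasis {:V}) i v * coord (vbasis {:W}) j w).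

Notation "v \ox w" := (tens v w)
  (at level 40, left associativity) : ring_scope.

(* The linear map V \otimes W -> U sending v \ox w to f v w, meaningful
   for a bilinear f. *)
Definition tlift (K : fieldType) (V W : vectType K) (U : lmodType K)
    (f : V -> W -> U) (t : V \otimes W) : U :=
  \sum_i \sum_j (t : 'M[K]_(_, _)) i j *:
    f (vbasis {:V})`_i (vbasis {:W})`_j.

Section TensorTheory.
Variables (K : fieldType) (V W : vectType K).
Implicit Type U : lmodType K.

Fact tlift_is_linear U (f : V -> W -> U) : linear (tlift f).
Proof.
move=> a s t; rewrite /tlift scaler_sumr -big_split /=.
apply: eq_bigr => i _; rewrite scaler_sumr -big_split /=.
by apply: eq_bigr => j _; rewrite !mxE scalerDl scalerA.
Qed.

HB.instance Definition _ U (f : V -> W -> U) :=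
  GRing.isLinear.Build K (V \otimes W)%type U *:%R (tlift f)
    (tlift_is_linear f).

Lemma tlift_linearf U (c : K) (h f g : V -> W -> U) (t : V \otimes W) :
  (forall v w, h v w = c *: f v w + g v w) ->
  tlift h t = c *: tlift f t + tlift g t.
Proof.
move=> hE; rewrite /tlift scaler_sumr -big_split /=.
apply: eq_bigr => i _; rewrite scaler_sumr -big_split /=.
by apply: eq_bigr => j _; rewrite hE scalerDr !scalerA mulrC.
Qed.

Fact tens_bilinear : bilinear_for *:%R *:%R (@tens K V W).
Proof.
split=> [w a v v' | v a w w']; apply/matrixP => i j; rewrite !mxE linearP /=.
  by rewrite mulrDl mulrA.
by rewrite mulrDr mulrCA.
Qed.

HB.instance Definition _ :=
  bilinear_isBilinear.Build K V W (V \otimes W)%type *:%R *:%R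
    (@tens K V W) tens_bilinear.

Lemma tlift_tens U (f : V -> W -> U) (v : V) (w : W) :
  bilinear_for *:%R *:%R f -> tlift f (v \ox w) = f v w.
Proof.
move=> [fl fr].
pose hl w0 := GRing.isLinear.Build K V U *:%R (f^~ w0) (fl w0).
pose L w0 : {linear V -> U} := HB.pack (f^~ w0) (hl w0).
pose hr v0 := GRing.isLinear.Build K W U *:%R (f v0) (fr v0).
pose R v0 : {linear W -> U} := HB.pack (f v0) (hr v0).
rewrite {2}(coord_vbasis (memvf v)) -[RHS]/(L w _) linear_sum.
apply: eq_bigr => i _; rewrite linearZ /=.
rewrite {2}(coord_vbasis (memvf w)) -[f _ _]/(R _ _) linear_sum scaler_sumr.
by apply: eq_bigr => j _; rewrite linearZ /= scalerA mxE.
Qed.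

Lemma tensE (t : V \otimes W) : t = tlift (@tens K V W) t.
Proof.
have cE (Z : vectType K) (i j : 'I_(\dim {:Z})) :
    coord (vbasis {:Z}) i (vbasis {:Z})`_j = (i == j)%:R.
  by rewrite coord_free ?(basis_free (vbasisP _)) // eq_sym.
apply/matrixP => i j; rewrite /tlift summxE (bigD1 i) //= summxE (bigD1 j) //=.
rewrite !mxE !cE !eqxx !mulr1 !big1 ?addr0 // => [k ki | k kj].
  by rewrite summxE big1 // => l _; rewrite !mxE !cE eq_sym (negPf ki) mul0r mulr0.
by rewrite !mxE !cE [j == k]eq_sym (negPf kj) !mulr0.
Qed.

Lemma tlift_unique U (f : V -> W -> U) (h : {linear V \otimes W -> U}) :
  (forall v w, h (v \ox w) = f v w) -> h =1 tlift f.
Proof.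
move=> hf t; rewrite {1}(tensE t) /tlift linear_sum; apply: eq_bigr => i _.
by rewrite linear_sum; apply: eq_bigr => j _; rewrite linearZ hf.
Qed.

Lemma tensor_ext U (h h' : {linear V \otimes W -> U}) :
  (forall v w, h (v \ox w) = h' (v \ox w)) -> h =1 h'.
Proof.
move=> hh' t; rewrite (@tlift_unique _ (fun v w => h' (v \ox w)) h) //.
by rewrite -(@tlift_unique _ (fun v w => h' (v \ox w)) h').
Qed.

End TensorTheory.

Section TensorAlgebra.
Variables (K : fieldType) (A B : fdAlgType K).
Local Notation T := (A \otimes B)%type.

Definition tensor_one : T := (1 : A) \ox (1 : B).

Definition tensor_mul (s t : T) : T :=
  tlift (fun (a : A) (b : B) =>
    tlift (fun (a' : A) (b' : B) => (a * a') \ox (b * b')) t) s.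

Fact tensor_mul_inner_bilinear (a : A) (b : B) :
  bilinear_for *:%R *:%R (fun (a' : A) (b' : B) => (a * a') \ox (b * b')).
Proof.
split=> [b' c x y | a' c x y] /=; rewrite mulrDr -fdscalerAr.
  exact: (tens_bilinear A B).1.
exact: (tens_bilinear A B).2.
Qed.

Fact tensor_mul_linearr (s : T) : linear (tensor_mul s).
Proof.
by move=> c x y; apply: tlift_linearf => a b; rewrite linearP.
Qed.

Fact tensor_mul_linearl (t : T) : linear (tensor_mul^~ t).
Proof. by move=> c x y; rewrite /tensor_mul linearP. Qed.

HB.instance Definition _ (s : T) :=
  GRing.isLinear.Build K T T *:%R (tensor_mul s) (tensor_mul_linearr s).

Definition tensor_mulr (t s : T) := tensor_mul s t.

HB.instance Definition _ (t : T) :=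
  GRing.isLinear.Build K T T *:%R (tensor_mulr t) (tensor_mul_linearl t).

Lemma tensor_mulE (a a' : A) (b b' : B) :
  tensor_mul (a \ox b) (a' \ox b') = (a * a') \ox (b * b').
Proof.
rewrite /tensor_mul tlift_tens.
  by rewrite tlift_tens //; apply: tensor_mul_inner_bilinear.
split=> [y c x x' | x c y y'] /=; apply: tlift_linearf => u w;
  rewrite mulrDl -fdscalerAl.
  by rewrite (tens_bilinear A B).1.
by rewrite (tens_bilinear A B).2.
Qed.

Fact tensor_mul1 : left_id tensor_one tensor_mul.
Proof.
apply: (@tensor_ext K A B T (tensor_mul tensor_one) idfun) => a b /=.
by rewrite tensor_mulE !mul1r.
Qed.

Fact tensor_mulr1 : right_id tensor_one tensor_mul.
Proof.
apply: (@tensor_ext K A B T (tensor_mulr tensor_one) idfun) => a b /=.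
by rewrite /tensor_mulr tensor_mulE !mulr1.
Qed.

Fact tensor_mulA : associative tensor_mul.
Proof.
move=> x y z; move: x.
apply: (@tensor_ext K A B T (tensor_mulr (tensor_mul y z))
  (tensor_mulr z \o tensor_mulr y)) => a b /=; rewrite /tensor_mulr; move: y.
apply: (@tensor_ext K A B T (tensor_mul (a \ox b) \o tensor_mulr z)
  (tensor_mulr z \o tensor_mul (a \ox b))) => a' b' /=.
rewrite /tensor_mulr tensor_mulE; move: z.
apply: (@tensor_ext K A B T
  (tensor_mul (a \ox b) \o tensor_mul (a' \ox b'))
  (tensor_mul ((a * a') \ox (b * b')))) => a'' b'' /=.
by rewrite !tensor_mulE !mulrA.
Qed.

Fact tensor_mulDl : left_distributive tensor_mul +%R.
Proof. by move=> x y z; rewrite -!/(tensor_mulr _ _) linearD. Qed.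

Fact tensor_mulDr : right_distributive tensor_mul +%R.
Proof. by move=> x y z; rewrite linearD. Qed.

HB.instance Definition _ := GRing.Zmodule_isPzRing.Build T
  tensor_mulA tensor_mul1 tensor_mulr1 tensor_mulDl tensor_mulDr.

End TensorAlgebra.

Definition tmap (K : fieldType) (V W V' W' : vectType K)
    (f : V -> V') (g : W -> W') : V \otimes W -> V' \otimes W' :=
  tlift (fun v w => f v \ox g w).

(* The canonical identification (U \otimes V) \otimes W = U \otimes (V \otimes W) *)
Definition tassoc (K : fieldType) (U V W : vectType K) :
    (U \otimes V) \otimes W -> U \otimes (V \otimes W) :=
  tlift (fun t w => tlift (fun u v => u \ox (v \ox w)) t).

(* f \otimes id and id \otimes f for a linear form f, with K \otimes W and
   V \otimes K identified with W and V. *)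
Definition tevall (K : fieldType) (V W : vectType K) (f : V -> K) :
    V \otimes W -> W :=
  tlift (fun v w => f v *: w).

Definition tevalr (K : fieldType) (V W : vectType K) (f : W -> K) :
    V \otimes W -> V :=
  tlift (fun v w => f w *: v).

Definition tmult (K : fieldType) (A : fdAlgType K) : A \otimes A -> A :=
  tlift (fun x y : A => x * y).

(* The identification C a = C b given by an equality a = b in the group, needed
   since e.g. C (a * (b * c)) and C (a * b * c) are distinct types. *)
Definition gcast (T : Type) (C : T -> Type) (a b : T) (e : a = b) (x : C a) :
    C b :=
  eq_rect a C x b e.

Record pi_coalgebra_axioms (pi : groupType) (K : fieldType)
    (C : pi -> vectType K)
    (Delta : forall a b : pi, {linear C (a * b)%g -> C a \otimes C b})
    (eps : {scalar C 1%g}) : Prop := {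
  coassociative : forall (a b c : pi) (x : C (a * b * c)%g),
    tassoc (tmap (Delta a b) idfun (Delta (a * b)%g c x)) =
    tmap idfun (Delta b c)
      (Delta a (b * c)%g (gcast (C := C) (esym (mulgA a b c)) x));
  counitr : forall (a : pi) (x : C (a * 1)%g),
    tevalr eps (Delta a 1%g x) = gcast (C := C) (mulg1 a) x;
  counitl : forall (a : pi) (x : C (1 * a)%g),
    tevall eps (Delta 1%g a x) = gcast (C := C) (mul1g a) x
}.

(* Finite dimensional Hopf pi-coalgebras: finite dimensionality is part of the
   type of the components. *)
Record hopf_pi_coalgebra (pi : groupType) (K : fieldType) := HopfPiCoalgebra {
  hcomp :> pi -> fdAlgType K;
  hDelta : forall a b : pi, {linear hcomp (a * b)%g -> hcomp a \otimes hcomp b};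
  heps : {scalar hcomp 1%g};
  hS : forall a : pi, {linear hcomp a -> hcomp a^-1%g};
  hcoalgebra : pi_coalgebra_axioms hDelta heps;
  hDelta_morphism : forall a b : pi, monoid_morphism (hDelta a b);
  heps_morphism : monoid_morphism heps;
  (* The antipode on H_(a^-1) takes values in H_((a^-1)^-1) = H_a. *)
  hantipodel : forall (a : pi) (x : hcomp (a^-1 * a)%g),
    tmult (tmap (fun y => gcast (C := hcomp) (invgK a) (hS a^-1%g y)) idfun
      (hDelta a^-1%g a x)) =
    heps (gcast (C := hcomp) (mulVg a) x) *: (1 : hcomp a);
  hantipoder : forall (a : pi) (x : hcomp (a * a^-1)%g),
    tmult (tmap idfun (fun y => gcast (C := hcomp) (invgK a) (hS a^-1%g y))
      (hDelta a a^-1%g x)) =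
    heps (gcast (C := hcomp) (mulgV a) x) *: (1 : hcomp a)
}.

Section Families.
Variables (pi : groupType) (K : fieldType) (H : hopf_pi_coalgebra pi K).

Definition right_pi_integral (lambda : forall a : pi, {scalar H a}) : Prop :=
  forall (a b : pi) (x : H (a * b)%g),
    tevall (lambda a) (hDelta H a b x) = lambda (a * b)%g x *: (1 : H b).

Definition pi_grouplike (g : forall a : pi, H a) : Prop :=
  (forall a b : pi, hDelta H a b (g (a * b)%g) = g a \ox g b) /\
  heps H (g 1%g) = 1.

End Families.

(* Main.v *)
(* The component H_1 is an ordinary finite dimensional Hopf algebra, so its
   right integrals form a line. A nonzero right integral mu of H_1 extends to a
   right pi-integral lambda: mu(x_1) x_2 in H_a is coinvariant under H_1, hence
   a scalar lambda_a(x) 1_a; conversely a right pi-integral is determined by its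
   component at 1. For a linear form f on H_a, the family
   f(x_1) lambda(x_2) is again a right pi-integral, hence g(f) lambda with g
   linear in f, that is g in H_a; coassociativity makes g grouplike. *)
Require Import Defs.
From HB Require Import structures.
From mathcomp Require Import all_boot all_order all_algebra.
From Stdlib Require Import FunctionalExtensionality.

Set Implicit Arguments.
Unset Strict Implicit.
Unset Printing Implicit Defensive.

Import GRing.Theory.
Local Open Scope ring_scope.

(* Sweedler notation: u and v stand for the two legs of t. *)
Notation "\sw_ ( u , v <- t ) F" := (tlift (fun u v => F) t)
  (at level 36, F at level 36, u name, v name, t at level 50,
   format "'[' \sw_ ( u ,  v  <-  t ) '/  '  F ']'") : ring_scope.

(** * Sums over the legs of a tensor *)

(** On H_1, existence of a nonzero integral rests on a trace formula with S^2, and uniqueness on the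
    pairing lam(y x): it is nondegenerate in y, so by dimension every linear form is lam(y .) for
    some y. Two features of the graded setting shape the rest. A component may be zero, and then a
    multiple of 1_a does not determine its coefficient; such cases are split off, the key fact being
    that H_a = 0 and H_b nonzero force H_(ab) = 0. And degrees such as c and a (a^-1 c) agree only
    propositionally, so the graded coproduct and antipode take an equation between degrees as an
    argument. Uniqueness of g comes from evaluating the required equation at an element where a
    right pi-integral takes the value 1. *)

Section LinearityPredicate.
Variables (K : fieldType) (V : lmodType K).
Variables (X Y : vectType K) (A B : fdAlgType K) (U U' : lmodType K).

Lemma linear_idfun : linear (fun x : V => x).
Proof. by []. Qed.

Lemma linear_app (h : {linear U -> U'}) (f : V -> U) :
  linear f -> linear (fun x => h (f x)).
Proof. by move=> lf a x y; rewrite lf linearP. Qed.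

Lemma scalar_app (h : {scalar U}) (f : V -> U) :
  linear f -> scalar (fun x => h (f x)).
Proof. by move=> lf a x y; rewrite lf linearP. Qed.

Lemma linear_scalel (f : V -> K) (w : U) :
  scalar f -> linear (fun x => f x *: w).
Proof. by move=> lf a x y; rewrite lf scalerDl scalerA. Qed.

Lemma linear_scaler (c : K) (f : V -> U) :
  linear f -> linear (fun x => c *: f x).
Proof. by move=> lf a x y; rewrite lf scalerDr !scalerA mulrC. Qed.

Lemma linear_mull (f : V -> A) (b : A) :
  linear f -> linear (fun x => f x * b).
Proof. by move=> lf a x y; rewrite lf mulrDl -fdscalerAl. Qed.

Lemma linear_mulr (b : A) (f : V -> A) :
  linear f -> linear (fun x => b * f x).
Proof. by move=> lf a x y; rewrite lf mulrDr -fdscalerAr. Qed.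

Lemma linear_tensl (f : V -> X) (b : Y) :
  linear f -> linear (fun x => f x \ox b).
Proof. by move=> lf a x y; rewrite lf (tens_bilinear X Y).1. Qed.

Lemma linear_tensr (b : X) (f : V -> Y) :
  linear f -> linear (fun x => b \ox f x).
Proof. by move=> lf a x y; rewrite lf (tens_bilinear X Y).2. Qed.

Lemma linear_tmull (f : V -> (A \otimes B)%type) (b : (A \otimes B)%type) :
  linear f -> linear (fun x => f x * b).
Proof. by move=> lf a x y; rewrite lf; apply: tensor_mul_linearl. Qed.

Lemma linear_tmulr (b : (A \otimes B)%type) (f : V -> (A \otimes B)%type) :
  linear f -> linear (fun x => b * f x).
Proof. by move=> lf a x y; rewrite lf; apply: tensor_mul_linearr. Qed.

Lemma linear_tlift (F : V -> X -> Y -> U) t :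
  (forall u v, linear (fun x => F x u v)) ->
  linear (fun x => tlift (F x) t).
Proof. by move=> lF a x y; apply: tlift_linearf => u v; apply: lF. Qed.

Lemma linear_tlift_arg (F : X -> Y -> U) (f : V -> (X \otimes Y)%type) :
  linear f -> linear (fun x => tlift F (f x)).
Proof. by move=> lf a x y; rewrite lf linearP. Qed.

Lemma linear_sumf (I : Type) (r : seq I) (P : pred I) (F : I -> V -> U) :
  (forall i, linear (F i)) -> linear (fun x => \sum_(i <- r | P i) F i x).
Proof.
move=> lF a x y; rewrite scaler_sumr -big_split /=.
by apply: eq_bigr => i _; apply: lF.
Qed.

End LinearityPredicate.

(** Summands in Sweedler notation are anonymous functions without a linear structure, so linearity
    is kept as a predicate and proved by the shape of the body. *)
Ltac lin := repeat first
  [ by [] | assumption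
  | apply: linear_idfun | exact: linearP
  | apply: scalar_app | apply: linear_scalel
  | apply: linear_scaler | apply: linear_mull | apply: linear_mulr
  | apply: linear_tensl | apply: linear_tensr | apply: linear_tmull
  | apply: linear_tmulr | apply: linear_tlift_arg
  | (apply: linear_tlift => ? ?) | (apply: linear_sumf => ?)
  | apply: linear_app ].

Ltac bilin := (split=> [? | ?] /=; lin).

Section TensorSums.
Variables (K : fieldType) (V W : vectType K).
Implicit Types (U : lmodType K) (t : (V \otimes W)%type).

Lemma eq_tlift U (f g : V -> W -> U) t : f =2 g -> tlift f t = tlift g t.
Proof.
by move=> fg; apply: eq_bigr => i _; apply: eq_bigr => j _; rewrite fg.
Qed.

Lemma tlift_eq0 U (f : V -> W -> U) t :
  (forall v w, f v w = 0) -> tlift f t = 0.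
Proof.
by move=> f0; rewrite /tlift big1 // => i _; rewrite big1 // => j _;
  rewrite f0 scaler0.
Qed.

Lemma sum_app U (U' : lmodType K) (h : U -> U') (I : Type) (r : seq I)
    (P : pred I) (F : I -> U) :
  linear h -> h (\sum_(i <- r | P i) F i) = \sum_(i <- r | P i) h (F i).
Proof.
move=> lh; pose L := GRing.isLinear.Build K U U' *:%R h lh.
pose h' : {linear U -> U'} := HB.pack h L.
by rewrite -[h]/(h' : U -> U') linear_sum.
Qed.

Lemma tlift_app U (U' : lmodType K) (h : U -> U') (f : V -> W -> U) t :
  linear h -> h (tlift f t) = \sw_(v, w <- t) h (f v w).
Proof.
move=> lh; rewrite /tlift sum_app //; apply: eq_bigr => i _.
by rewrite sum_app //; apply: eq_bigr => j _; rewrite (scalable_linear lh).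
Qed.

(** The target of [tlift] has to be a module, so a sum of scalars lives in [K^o]. *)
Lemma tlift_appK U (h : U -> K) (f : V -> W -> U) t :
  scalar h -> h (tlift f t) = tlift (fun v w => h (f v w) : K^o) t.
Proof. by move=> lh; apply: (@tlift_app U K^o). Qed.

Lemma tlift_sum U (I : Type) (r : seq I) (P : pred I) (F : I -> V -> W -> U) t :
  \sw_(v, w <- t) (\sum_(i <- r | P i) F i v w) =
  \sum_(i <- r | P i) tlift (F i) t.
Proof.
rewrite [RHS]exchange_big /=; apply: eq_bigr => k _.
rewrite [RHS]exchange_big /=; apply: eq_bigr => l _.
by rewrite scaler_sumr.
Qed.

Lemma tlift_exchange (X Y : vectType K) U (F : V -> W -> X -> Y -> U) t
    (s : (X \otimes Y)%type) :
  \sw_(v, w <- t) \sw_(x, y <- s) F v w x y =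
  \sw_(x, y <- s) \sw_(v, w <- t) F v w x y.
Proof.
rewrite [LHS]tlift_sum; apply: eq_bigr => i _; rewrite tlift_sum.
apply: eq_bigr => j _.
by rewrite [RHS](@tlift_app _ _ (fun x => _ *: x)) //; lin.
Qed.

Lemma tlift_tmapl (X : vectType K) U (f : V -> X) (F : X -> W -> U) t :
  bilinear_for *:%R *:%R F ->
  tlift F (tmap f idfun t) = \sw_(v, w <- t) F (f v) w.
Proof.
move=> bF; rewrite [LHS]tlift_app; last by lin.
by apply: eq_tlift => v w; rewrite tlift_tens.
Qed.

Lemma tlift_tmapr (X : vectType K) U (f : W -> X) (F : V -> X -> U) t :
  bilinear_for *:%R *:%R F ->
  tlift F (tmap idfun f t) = \sw_(v, w <- t) F v (f w).
Proof.
move=> bF; rewrite [LHS]tlift_app; last by lin.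
by apply: eq_tlift => v w; rewrite tlift_tens.
Qed.

End TensorSums.

Section TensorTriple.
Variables (K : fieldType) (X Y Z : vectType K) (U : lmodType K).
Variables (F : X -> Y -> Z -> U).
Hypotheses (lF1 : forall y z, linear (fun x => F x y z))
           (lF2 : forall x z, linear (fun y => F x y z))
           (lF3 : forall x y, linear (F x y)).

Lemma tlift_tassoc (t : ((X \otimes Y) \otimes Z)%type) :
  \sw_(x, s <- tassoc t) tlift (F x) s =
  \sw_(s, z <- t) \sw_(x, y <- s) F x y z.
Proof.
rewrite [LHS]tlift_app; last by lin.
apply: eq_tlift => s z; rewrite [LHS]tlift_app; last by lin.
apply: eq_tlift => x y; rewrite tlift_tens; first by rewrite tlift_tens.
by split=> [s' | x']; [apply: linear_tlift => *|apply: linear_tlift_arg].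
Qed.

(** The maps [f] and [g] are unrelated, so that the coproduct of a single Hopf algebra and the
    coproducts of varying degrees are both instances. *)
Lemma tlift_coassoc (V W : vectType K) (f : V -> (X \otimes Y)%type)
    (g : W -> (Y \otimes Z)%type) s t :
  tassoc (tmap f idfun s) = tmap idfun g t ->
  \sw_(v, z <- s) \sw_(x, y <- f v) F x y z =
  \sw_(x, w <- t) \sw_(y, z <- g w) F x y z.
Proof.
move/(congr1 (tlift (fun p s => tlift (F p) s))).
by rewrite tlift_tassoc // !(tlift_tmapl, tlift_tmapr) //; bilin.
Qed.

End TensorTriple.

Section TensorSumMul.
Variables (K : fieldType) (V W : vectType K) (A B : fdAlgType K).
Implicit Types (t : (V \otimes W)%type).

Lemma tlift_scaler (U : lmodType K) c (f : V -> W -> U) t :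
  c *: tlift f t = \sw_(v, w <- t) (c *: f v w).
Proof. by rewrite (tlift_app (h := *:%R c)) //; lin. Qed.

Lemma tlift_mull (f : V -> W -> A) t b :
  tlift f t * b = tlift (fun v w => f v w * b) t.
Proof. by rewrite (tlift_app (h := fun x : A => x * b)) //; lin. Qed.

Lemma tlift_tmull (f : V -> W -> (A \otimes B)%type) t b :
  tlift f t * b = tlift (fun v w => f v w * b) t.
Proof.
by rewrite (tlift_app (h := fun x : (A \otimes B)%type => x * b)) //; lin.
Qed.

Lemma tlift_tmulr (f : V -> W -> (A \otimes B)%type) t b :
  b * tlift f t = tlift (fun v w => b * f v w) t.
Proof.
by rewrite (tlift_app (h := fun x : (A \otimes B)%type => b * x)) //; lin.
Qed.

End TensorSumMul.

Section TensorScale.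
Variables (K : fieldType) (A B : fdAlgType K).
Implicit Types (s t : (A \otimes B)%type).

Lemma tensor_scalerAl (c : K) s t : c *: (s * t) = (c *: s) * t.
Proof. exact/esym/(scalable_linear (tensor_mul_linearl t)). Qed.

Lemma tensor_scalerAr (c : K) s t : c *: (s * t) = s * (c *: t).
Proof. exact/esym/(scalable_linear (tensor_mul_linearr s)). Qed.

End TensorScale.

Lemma tmultE (K : fieldType) (V W : vectType K) (A : fdAlgType K)
    (f : V -> A) (g : W -> A) (t : (V \otimes W)%type) :
  tmult (tmap f g t) = \sw_(v, w <- t) (f v * g w).
Proof.
rewrite [LHS]tlift_app; last by apply: linear_tlift_arg.
by apply: eq_tlift => v w; rewrite /tmult tlift_tens //; bilin.
Qed.

Lemma tlift_mul (K : fieldType) (A B : fdAlgType K) (U : lmodType K)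
    (F : A -> B -> U) (s t : (A \otimes B)%type) :
  bilinear_for *:%R *:%R F ->
  tlift F (s * t) =
  tlift (fun (a : A) (b : B) =>
    tlift (fun (a' : A) (b' : B) => F (a * a') (b * b')) t) s.
Proof.
move=> bF; rewrite [LHS]tlift_app; last by lin.
apply: eq_tlift => a b; rewrite [LHS]tlift_app; last by lin.
by apply: eq_tlift => a' b'; rewrite tlift_tens.
Qed.

Lemma tens_mul (K : fieldType) (A B : fdAlgType K) (a a' : A) (b b' : B) :
  (a \ox b) * (a' \ox b') = (a * a') \ox (b * b').
Proof. exact: tensor_mulE. Qed.

(** * Integrals of a finite dimensional Hopf algebra *)

Section HopfAlgebra.
Variables (K : fieldType) (A : fdAlgType K).
Variables (D : {linear A -> A \otimes A}) (eps : {scalar A})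
          (S : {linear A -> A}).
Local Notation "\sw_ ( u , v <- t ) F" :=
  (tlift (fun u v : A => F) t) : ring_scope.
Hypothesis D_coassoc :
  forall x, tassoc (tmap D idfun (D x)) = tmap idfun D (D x).
Hypothesis D_counitl : forall x, tevall eps (D x) = x.
Hypothesis D_counitr : forall x, tevalr eps (D x) = x.
Hypothesis D_morphism : monoid_morphism D.
Hypothesis eps_morphism : monoid_morphism eps.
Hypothesis antipodel : forall x, \sw_(u, v <- D x) (S u * v) = eps x *: (1 : A).
Hypothesis antipoder : forall x, \sw_(u, v <- D x) (u * S v) = eps x *: (1 : A).

Lemma coassocE (U : lmodType K) (F : A -> A -> A -> U) x :
  (forall q w, linear (fun p => F p q w)) ->
  (forall p w, linear (fun q => F p q w)) ->
  (forall p q, linear (F p q)) ->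
  \sw_(u, w <- D x) \sw_(p, q <- D u) F p q w =
  \sw_(p, v <- D x) \sw_(q, w <- D v) F p q w.
Proof.
by move=> *; apply: tlift_coassoc => //; apply: D_coassoc.
Qed.

Lemma counitlE (U : lmodType K) (f : A -> U) x :
  linear f -> \sw_(u, v <- D x) (eps u *: f v) = f x.
Proof.
move=> lf; rewrite -{2}(D_counitl x) tlift_app //.
by apply: eq_tlift => u v; rewrite (scalable_linear lf).
Qed.

Lemma counitrE (U : lmodType K) (f : A -> U) x :
  linear f -> \sw_(u, v <- D x) (eps v *: f u) = f x.
Proof.
move=> lf; rewrite -{2}(D_counitr x) tlift_app //.
by apply: eq_tlift => u v; rewrite (scalable_linear lf).
Qed.

Lemma antipodelE (U : lmodType K) (f : A -> U) x :
  linear f -> \sw_(u, v <- D x) f (S u * v) = eps x *: f 1.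
Proof.
by move=> lf; rewrite -(scalable_linear lf) -antipodel tlift_app.
Qed.

Lemma antipoderE (U : lmodType K) (f : A -> U) x :
  linear f -> \sw_(u, v <- D x) f (u * S v) = eps x *: f 1.
Proof.
by move=> lf; rewrite -(scalable_linear lf) -antipoder tlift_app.
Qed.

(** * The antipode against coproduct and counit *)

Lemma coproduct1 : D 1 = (1 : A) \ox (1 : A). Proof. exact: D_morphism.1. Qed.

Lemma coproductM x y : D (x * y) = D x * D y. Proof. exact: D_morphism.2. Qed.

(** In w_1 S(w_4) \ox w_2 S(w_3) the inner pair collapses, and then the outer one. *)
Lemma antipode_conv_inv w :
  \sw_(p, q <- D w) (D p * \sw_(a, b <- D q) (S b \ox S a)) =
  eps w *: ((1 : A) \ox (1 : A)).
Proof.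
pose G a b c d : (A \otimes A)%type := (a * S d) \ox (b * S c).
transitivity (\sw_(p, q <- D w) \sw_(a, b <- D p) \sw_(c, d <- D q) G a b c d).
  apply: eq_tlift => p q; rewrite {1}(tensE (D p)) tlift_tmull.
  apply: eq_tlift => a b; rewrite tlift_tmulr.
  by apply: eq_tlift => c d; rewrite tens_mul.
rewrite (coassocE (F := fun a b q => \sw_(c, d <- D q) G a b c d));
  try by rewrite /G => *; lin.
transitivity (\sw_(a, v <- D w) ((a * S v) \ox (1 : A) : (A \otimes A)%type)).
  apply: eq_tlift => a v.
  rewrite -(coassocE (F := fun b c d => G a b c d));
    try by rewrite /G => *; lin.
  rewrite -[RHS](@counitlE _ (fun v => (a * S v) \ox (1 : A))); last by lin.
  by apply: eq_tlift => e d; rewrite (@antipoderE _ (fun x => _ \ox x));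
    last by lin.
by rewrite (@antipoderE _ (fun x => x \ox (1 : A))); last by lin.
Qed.

(* The two sides are a left and a right convolution inverse of D. *)
Lemma antipode_comul x :
  D (S x) = \sw_(u, v <- D x) (S v \ox S u).
Proof.
pose R q := \sw_(a, b <- D q) (S b \ox S a).
have lR : linear R by rewrite /R; lin.
(* Summed over x_1, x_2, x_3: the last two factors collapse and leave D(S x), the first two collapse
   and leave R(x). *)
pose F p q r := D (S p) * D q * R r.
have one1 : (1 : A) \ox (1 : A) = 1 :> (A \otimes A)%type by [].
transitivity (\sw_(u, w <- D x) \sw_(p, q <- D w) F u p q).
  rewrite -[LHS](@counitrE _ (fun x => D (S x))); last by lin.
  apply: eq_tlift => u w; rewrite /F.
  transitivity (D (S u) * \sw_(p, q <- D w) (D p * R q)).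
    by rewrite antipode_conv_inv one1 -tensor_scalerAr mulr1.
  by rewrite tlift_tmulr; apply: eq_tlift => p q; rewrite mulrA.
rewrite -coassocE; try by rewrite /F => *; lin.
rewrite -[RHS](@counitlE _ R) //; apply: eq_tlift => u w.
rewrite -tlift_tmull.
transitivity ((eps u *: (1 : (A \otimes A)%type)) * R w).
  congr (_ * _); rewrite -one1 -coproduct1 -(@antipodelE _ D); last by lin.
  by apply: eq_tlift => p q; rewrite coproductM.
by rewrite -tensor_scalerAl mul1r.
Qed.

Lemma antipode1 : S 1 = 1.
Proof.
have : \sw_(u, v <- D 1) (S u * v) = S 1.
  by rewrite coproduct1 tlift_tens ?mulr1 //; bilin.
by rewrite antipodel eps_morphism.1 scale1r.
Qed.

Lemma counit_antipode x : eps (S x) = eps x.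
Proof.
have := congr1 eps (antipodel x).
rewrite linearZ /= eps_morphism.1 mulr1 => <-.
rewrite -{1}[x](@counitrE _ idfun) // (tlift_appK (h := fun x => eps (S x))).
  rewrite tlift_appK; last exact: linearP.
  by apply: (@eq_tlift _ _ _ K^o) => u v;
    rewrite !linearZ /= eps_morphism.2 mulrC.
by lin.
Qed.

(** In [inv] the second leg is w_1 S(w_2) and collapses. The lemma is [inv] at w = S y, whose
    coproduct is S(y_2) \ox S(y_1). *)
Lemma antipode_sq_invariant y :
  \sw_(u, v <- D y) (((1 : A) \ox S v) * D (S (S u))) = S (S y) \ox (1 : A).
Proof.
have inv w : \sw_(a, b <- D w) (((1 : A) \ox a) * D (S b)) = S w \ox (1 : A).
  transitivity (\sw_(a, b <- D w) \sw_(p, q <- D b) (S q \ox (a * S p))).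
    apply: eq_tlift => a b; rewrite antipode_comul tlift_tmulr.
    by apply: eq_tlift => p q; rewrite tens_mul mul1r.
  rewrite -(coassocE (F := fun a p q => S q \ox (a * S p)));
    try by move=> *; lin.
  rewrite -[RHS](@counitlE _ (fun w => S w \ox (1 : A))); last by lin.
  apply: eq_tlift => e q.
  by rewrite (@antipoderE _ (fun x => S q \ox x)); last by lin.
rewrite -inv antipode_comul tlift_app; last by lin.
by apply: eq_tlift => u v; rewrite tlift_tens //; bilin.
Qed.

(** The identity [antipodel] at S y. *)
Lemma antipode_sq_antipode y :
  \sw_(u, v <- D y) (S (S v) * S u) = eps y *: (1 : A).
Proof.
rewrite -counit_antipode -antipodel antipode_comul tlift_app; last by lin.
by apply: eq_tlift => u v; rewrite tlift_tens //; bilin.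
Qed.

Lemma antipode_sq_antipodeE (U : lmodType K) (f : A -> U) y :
  linear f -> \sw_(u, v <- D y) f (S (S v) * S u) = eps y *: f 1.
Proof.
by move=> lf; rewrite -(scalable_linear lf) -antipode_sq_antipode tlift_app.
Qed.

(** * A nonzero right integral from traces *)

Local Notation e i := (vbasis {:A})`_i.
Local Notation c i := (coord (vbasis {:A}) i).

Lemma basisE (U : lmodType K) (f : A -> U) x :
  linear f -> \sum_i c i x *: f (e i) = f x.
Proof.
move=> lf; rewrite [x in RHS](coord_vbasis (memvf x)) sum_app //.
by apply: eq_bigr => i _; rewrite (scalable_linear lf).
Qed.

Definition right_integral (lam : A -> K) :=
  forall x, \sw_(u, v <- D x) (lam u *: v) = lam x *: (1 : A).

Definition twist (b : A -> K) y := \sw_(u, v <- D y) (b u *: S (S v)).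

Lemma linear_twist b : linear (twist b).
Proof. by rewrite /twist; lin. Qed.

Lemma twist_invariant (b : {scalar A}) y :
  \sw_(u, v <- D y) (((1 : A) \ox S v) * D (twist b u)) =
  twist b y \ox (1 : A).
Proof.
pose F p q v := b p *: (((1 : A) \ox S v) * D (S (S q))).
transitivity (\sw_(u, v <- D y) \sw_(p, q <- D u) F p q v).
  apply: eq_tlift => u v.
  rewrite (tlift_app (h := fun x => ((1 : A) \ox S v) * D x)); last by lin.
  by apply: eq_tlift => p q; rewrite /F linearZ tensor_scalerAr.
rewrite coassocE; try by rewrite /F => *; lin.
rewrite (tlift_app (h := fun x => x \ox (1 : A))); last by lin.
apply: eq_tlift => p s; rewrite /F -tlift_scaler antipode_sq_invariant.
by rewrite linearZl_LR.
Qed.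

(* The trace of y |-> b(y_1) S^2(y_2) x: the coinvariant projection of the Hopf
   module of linear forms, applied to b. *)
Definition trace_integral (b : A -> K) x := \sum_i c i (twist b (e i) * x).

Lemma scalar_trace_integral b : scalar (trace_integral b).
Proof.
move=> a x y; rewrite /trace_integral mulr_sumr -big_split /=.
by apply: eq_bigr => i _; rewrite mulrDr -fdscalerAr linearP.
Qed.

Lemma tevall_mul (f : {scalar A}) (a b : A) (t : (A \otimes A)%type) :
  tevall f ((a \ox b) * t) = \sw_(u, v <- t) (f (a * u) *: (b * v)).
Proof.
rewrite {1}(tensE t) tlift_tmulr tlift_app; last by rewrite /tevall; lin.
by apply: eq_tlift => u v; rewrite tens_mul /tevall tlift_tens //; bilin.
Qed.

Lemma trace_integralP (b : {scalar A}) : right_integral (trace_integral b).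
Proof.
move=> x; pose G := twist b; have lG : linear G by exact: linear_twist.
pose F i j p q u v := c i u *: (c j (G p * x) *: (S q * v)).
(* Multiplying [twist_invariant] by D x on the right puts G(y_1) x under one coproduct; expanding it
   in the basis gives the sum over j. *)
have step i y : \sw_(u, v <- D x) (c i (G y * u) *: v) =
    \sum_j \sw_(u, v <- D (e j)) \sw_(p, q <- D y) F i j p q u v.
  transitivity (tevall (c i) ((G y \ox (1 : A)) * D x)).
    by rewrite tevall_mul; apply: eq_tlift => u v; rewrite mul1r.
  rewrite -twist_invariant tlift_tmull tlift_app; last by rewrite /tevall; lin.
  transitivity (\sum_j \sw_(p, q <- D y) \sw_(u, v <- D (e j)) F i j p q u v).
    rewrite -tlift_sum; apply: eq_tlift => p q;
    rewrite -mulrA -coproductM tevall_mul.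
    rewrite -[LHS](basisE
      (f := fun z => \sw_(u, v <- D z) (c i (1 * u) *: (S q * v))));
      last by lin.
    apply: eq_bigr => j _; rewrite tlift_scaler.
    by apply: eq_tlift => u v; rewrite /F mul1r scalerA mulrC -scalerA.
  by apply: eq_bigr => j _; rewrite tlift_exchange.
transitivity (\sum_i \sw_(u, v <- D x) (c i (G (e i) * u) *: v)).
  by rewrite -tlift_sum; apply: eq_tlift => u v; rewrite -scaler_suml.
under eq_bigr do rewrite step.
rewrite exchange_big scaler_suml /=; apply: eq_bigr => j _.
rewrite -tlift_sum.
(* The sum over i of c_i(u) times a linear expression in e_i is that expression at u. What remains
   for y = e_j contains S(y_2) y_3, which collapses. *)
pose P p q v := c j (G p * x) *: (S q * v).
transitivity (\sw_(u, v <- D (e j)) \sw_(p, q <- D u) P p q v).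
  apply: eq_tlift => u v.
  rewrite -[RHS](basisE (f := fun y => \sw_(p, q <- D y) P p q v)); last by lin.
  by apply: eq_bigr => i _; rewrite tlift_scaler.
rewrite coassocE; try by rewrite /P => *; lin.
rewrite -(counitrE (f := fun p => c j (G p * x) *: (1 : A))); last by lin.
apply: eq_tlift => p s; rewrite -tlift_scaler antipodel.
by rewrite !scalerA mulrC.
Qed.

(* If all trace integrals vanish then W = 0, but x is recovered from the values
   of W because S^2(y_2) S(y_1) = eps(y). *)
Lemma trace_integral_neq0 (x : A) :
  x != 0 -> exists (b : {scalar A}) y, trace_integral b y != 0.
Proof.
move=> nzx.
pose W (x : A) := \sum_i \sw_(u, v <- D (e i)) (c i (S (S v) * x) *: u).
have WE (b : {scalar A}) y : trace_integral b y = b (W y).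
  rewrite /trace_integral linear_sum; apply: eq_bigr => i _.
  rewrite tlift_appK; last exact: linearP.
  rewrite /twist tlift_mull tlift_appK; last exact: linearP.
  apply: (@eq_tlift _ _ _ K^o) => u v.
  by rewrite -fdscalerAl !linearZ /= mulrC.
have [j Wj] : exists j : 'I_(\dim {:A}), W (e j) != 0.
  apply/existsP; apply: contraR nzx; rewrite negb_exists => /forallP W0.
  pose P i (p q v : A) := c i (S (S v) * (S q * x)) *: p.
  (* With y = e_i, write c_i(x) e_i as c_i(S^2(y_3) S(y_2) x) y_1 and expand S(y_2) x in the basis
     e_j; the sum over i then assembles the coproduct of W(e_j). *)
  suff -> : x = \sum_j \sw_(p, q <- D (W (e j))) (c j (S q * x) *: p).
    rewrite big1 // => j _; move: (W0 j); rewrite negbK => /eqP->.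
    by rewrite !linear0.
  transitivity (\sum_i \sw_(u, v <- D (e i)) \sw_(p, q <- D u) P i p q v).
    transitivity (\sum_i c i x *: e i); first exact/coord_vbasis/memvf.
    apply: eq_bigr => i _.
    rewrite coassocE; try by rewrite /P => *; lin.
    rewrite -(counitrE (f := fun p => c i x *: p)); last by lin.
    apply: eq_tlift => p s; rewrite -[in LHS](mul1r x).
    rewrite -(antipode_sq_antipodeE (f := fun z => c i (z * x) *: p));
      last by lin.
    by apply: eq_tlift => q v; rewrite /P mulrA.
  pose Q i (j : 'I_(\dim {:A})) (u v p q : A) :=
    c i (S (S v) * e j) *: (c j (S q * x) *: p).
  transitivity (\sum_j \sum_i \sw_(u, v <- D (e i))
    \sw_(p, q <- D u) Q i j u v p q).
    rewrite [RHS]exchange_big; apply: eq_bigr => i _; rewrite -tlift_sum.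
    apply: eq_tlift => u v; rewrite -tlift_sum; apply: eq_tlift => p q.
    rewrite /P -(basisE (f := fun z => c i (S (S v) * z) *: p)); last by lin.
    by apply: eq_bigr => j _; rewrite /Q !scalerA mulrC.
  apply: eq_bigr => j _.
  rewrite (sum_app (h := fun z => \sw_(p, q <- D z) (c j (S q * x) *: p)));
    last by lin.
  apply: eq_bigr => i _.
  rewrite (tlift_app (h := fun z => \sw_(p, q <- D z) (c j (S q * x) *: p)));
    last by lin.
  by apply: eq_tlift => u v; rewrite !linearZ /= tlift_scaler.
have [i Wi] : exists i : 'I_(\dim {:A}), c i (W (e j)) != 0.
  apply/existsP; apply: contraR Wj; rewrite negb_exists => /forallP c0.
  rewrite [W _](coord_vbasis (memvf _)) big1 // => i _.
  by move: (c0 i); rewrite negbK => /eqP->; rewrite scale0r.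
by exists (c i), (e j); rewrite WE.
Qed.

(** * The form lam(y x) of a right integral, and uniqueness up to scalars *)

Section RightIntegral.
Variable lam : {scalar A}.
Hypothesis lamP : right_integral lam.

(** Insert x_2 S(x_3) behind y_2: then y_1 x_1 and y_2 x_2 are the legs of D(y x_1), and the
    integral property applies to them. *)
Lemma right_integral_antipode x y :
  \sw_(u, v <- D y) (lam (u * x) *: v) =
  \sw_(p, q <- D x) (lam (y * p) *: S q).
Proof.
pose F (u v p r q : A) := lam (u * p) *: (v * (r * S q)).
transitivity (\sw_(u, v <- D y) \sw_(p, s <- D x) \sw_(r, q <- D s)
  F u v p r q).
  apply: eq_tlift => u v.
  rewrite -[LHS](counitrE (f := fun p => lam (u * p) *: v)); last by lin.
  apply: eq_tlift => p s.
  rewrite (antipoderE (f := fun z => lam (u * p) *: (v * z))); last by lin.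
  by rewrite mulr1.
transitivity (\sw_(u, v <- D y) \sw_(z, q <- D x) \sw_(p, r <- D z)
  F u v p r q).
  by apply: eq_tlift => u v; rewrite coassocE // /F => *; lin.
rewrite tlift_exchange; apply: eq_tlift => z q.
transitivity (\sw_(a, b <- D (y * z)) (lam a *: (b * S q))).
  rewrite coproductM tlift_mul; last by bilin.
  by apply: eq_tlift => u v; apply: eq_tlift => p r; rewrite /F mulrA.
transitivity ((\sw_(a, b <- D (y * z)) (lam a *: b)) * S q).
  by rewrite tlift_mull; apply: eq_tlift => a b; rewrite fdscalerAl.
by rewrite lamP -fdscalerAl mul1r.
Qed.

(* Expresses lam(x) y = lam(y_1 S(y_2) x) y_3 through the map
   z |-> lam(y_1 z) y_2 alone. *)
Lemma right_integral_recover x y (f : A -> A) :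
  (forall z, \sw_(u, v <- D y) (lam (u * z) *: v) = f z) ->
  lam x *: y =
  \sum_j \sw_(v, w <- D (f (e j))) (c j (S v * x) *: w).
Proof.
move=> fE; pose F (u v w : A) := lam (u * (S v * x)) *: w.
transitivity (\sw_(u, t <- D y) \sw_(v, w <- D t) F u v w).
  rewrite -coassocE; try by rewrite /F => *; lin.
  rewrite -(counitlE (f := fun w => lam x *: w)); last by lin.
  apply: eq_tlift => z w; rewrite -{1}[x]mul1r.
  rewrite -(antipoderE (f := fun z => lam (z * x) *: w)); last by lin.
  by apply: eq_tlift => u v; rewrite /F mulrA.
pose G (j : 'I_(\dim {:A})) (v w : A) := c j (S v * x) *: w.
transitivity (\sum_(j < \dim {:A}) \sw_(u, t <- D y)
  (lam (u * e j) *: \sw_(v, w <- D t) G j v w)).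
  rewrite -tlift_sum; apply: eq_tlift => u t.
  transitivity (\sw_(v, w <- D t) \sum_(j < \dim {:A})
      lam (u * e j) *: G j v w).
    apply: eq_tlift => v w.
    rewrite /F -(basisE (f := fun z => lam (u * z) *: w)); last by lin.
    by apply: eq_bigr => j _; rewrite !scalerA mulrC.
  by rewrite tlift_sum; apply: eq_bigr => j _; rewrite tlift_scaler.
apply: eq_bigr => j _; rewrite -fE.
rewrite (tlift_app (h := fun z => \sw_(v, w <- D z) G j v w));
  last by rewrite /G; lin.
by apply: eq_tlift => u t; rewrite !linearZ.
Qed.

Hypothesis lam_neq0 : exists x, lam x != 0.

(** By [right_integral_antipode], lam(y_1 z) y_2 vanishes for all z, so [right_integral_recover]
    applies with f = 0. *)
Lemma right_integral_inj y : (forall x, lam (y * x) = 0) -> y = 0.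
Proof.
move=> y0; have [x nz] := lam_neq0; apply/(scalerI nz).
rewrite scaler0 (@right_integral_recover x y (fun=> 0)) => [|z].
  by rewrite big1 // => j _; rewrite !linear0.
by rewrite right_integral_antipode tlift_eq0 // => p q; rewrite y0 scale0r.
Qed.

(** The Frobenius property. [T] encodes the form lam(y .) by its values on the basis, which makes it
    an endomorphism of A: being injective, it is onto. *)
Lemma right_integral_surj (mu : {scalar A}) :
  exists y, forall x, mu x = lam (y * x).
Proof.
pose T (y : A) := \sum_(i < \dim {:A}) lam (y * e i) *: e i.
have lT : linear T by rewrite /T; lin.
pose hT := GRing.isLinear.Build K A A *:%R T lT.
pose T' : {linear A -> A} := HB.pack T hT.
have coordT (a : 'I_(\dim {:A}) -> K) i : c i (\sum_j a j *: e j) = a i.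
  by rewrite coord_sum_free ?(basis_free (vbasisP _)).
have : lker (linfun T') == 0%VS.
  apply/lker0P => y z; rewrite !lfunE => /= yz; apply/eqP; rewrite -subr_eq0.
  apply/eqP/right_integral_inj => x.
  have T0 : T (y - z) = 0.
    by rewrite -[T]/(T' : _ -> _) linearB /= yz subrr.
  transitivity (\sum_i c i x *: (lam ((y - z) * e i) : K^o)).
    by rewrite (basisE (f := fun x => lam ((y - z) * x) : K^o)) //; lin.
  rewrite big1 // => i _.
  rewrite -(coordT (fun i => lam ((y - z) * e i))) -/(T (y - z)).
  by rewrite T0 linear0 scaler0.
move=> /lker0_limgf im.
have : \sum_(i < \dim {:A}) mu (e i) *: e i \in limg (linfun T')
  by rewrite im memvf.
case/memv_imgP => y _; rewrite lfunE /= /T => E; exists y => x.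
transitivity (\sum_i c i x *: (mu (e i) : K^o)).
  by rewrite (basisE (f := mu : A -> K^o)) //; lin.
rewrite -[RHS](basisE (f := fun x => lam (y * x) : K^o)); last by lin.
by apply: eq_bigr => i _; move/(congr1 (c i)): E; rewrite !coordT => ->.
Qed.

Lemma right_integral_unique (mu : {scalar A}) :
  right_integral mu -> exists k, forall x, mu x = k * lam x.
Proof.
move=> muP; have [y muE] := right_integral_surj mu; have [x nz] := lam_neq0.
(* As mu = lam(y .) is a right integral, lam(y_1 z) y_2 = S(mu(z_1) z_2) = mu(z) 1. Recovering y
   from this makes lam(x) y a multiple of 1, with k equal to mu(x) written in coordinates. *)
pose k := \sum_(j < \dim {:A}) lam (y * e j) * c j x.
have yE : lam x *: y = k *: (1 : A).
  rewrite (@right_integral_recover x y (fun z => lam (y * z) *: (1 : A))).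
    rewrite scaler_suml; apply: eq_bigr => j _.
    rewrite linearZ coproduct1 linearZ /= tlift_tens; last by bilin.
    by rewrite antipode1 mul1r scalerA.
  move=> z; rewrite right_integral_antipode.
  transitivity (S (\sw_(p, q <- D z) (mu p *: q))).
    by rewrite tlift_app; [apply: eq_tlift => p q; rewrite linearZ muE | lin].
  by rewrite muP linearZ /= antipode1 muE.
exists ((lam x)^-1 * k) => z; move: k yE => k yE.
have /(congr1 (fun y => (lam x)^-1 *: y)) := yE.
rewrite !scalerA mulVf // scale1r muE => ->.
by rewrite -fdscalerAl mul1r linearZ.
Qed.

End RightIntegral.

Lemma right_integral_exists :
  exists lam : {scalar A}, right_integral lam /\ exists x, lam x != 0.
Proof.
have one0 : (1 : A) != 0.
  apply/eqP => /(congr1 eps); rewrite eps_morphism.1 linear0.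
  by move/eqP; rewrite oner_eq0.
have [b [y nz]] := trace_integral_neq0 one0.
pose h := GRing.isLinear.Build K A K *%R (trace_integral b)
  (scalar_trace_integral b).
pose lam : {scalar A} := HB.pack (trace_integral b) h.
by exists lam; split; [exact: trace_integralP | exists y].
Qed.

End HopfAlgebra.

(** * Linear forms that read off coefficients *)

Section DualVector.
Variables (K : fieldType) (V : vectType K).
Implicit Types (u v x : V).

(* A linear form with value 1 at v if v != 0, and the zero form otherwise. *)
Definition dual_vector v x : K :=
  if [pick i | coord (vbasis {:V}) i v != 0] is Some i
  then (coord (vbasis {:V}) i v)^-1 * coord (vbasis {:V}) i x else 0.

Fact scalar_dual_vector v : scalar (dual_vector v).
Proof.
move=> a x y; rewrite /dual_vector; case: pickP => [i _ | _].
  by rewrite linearP /= mulrDr mulrCA.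
by rewrite mulr0 addr0.
Qed.

HB.instance Definition _ v :=
  GRing.isLinear.Build K V K *%R (dual_vector v) (scalar_dual_vector v).

Lemma scalar_ext u v : (forall f : {scalar V}, f u = f v) -> u = v.
Proof.
move=> fuv; rewrite [u](coord_vbasis (memvf _)) [v](coord_vbasis (memvf _)).
by apply: eq_bigr => i _; rewrite fuv.
Qed.

Lemma dual_vectorE v : v != 0 -> dual_vector v v = 1.
Proof.
rewrite /dual_vector; case: pickP => [i nz _ | c0 /eqP[]]; first exact: mulVf.
rewrite [v](coord_vbasis (memvf _)) big1 // => i _.
by rewrite (eqP (negbFE (c0 i))) scale0r.
Qed.

End DualVector.

(** * Integrals of a Hopf pi-coalgebra *)

Section Graded.
Variables (pi : groupType) (K : fieldType) (H : hopf_pi_coalgebra pi K).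
Implicit Types (a b c : pi).

Lemma gcast_id (C : pi -> Type) a (e : a = a) (x : C a) :
  gcast (C := C) e x = x.
Proof. by rewrite (eq_irrelevance e erefl). Qed.

Lemma gcastK (C : pi -> Type) a b (e : a = b) (e' : b = a) (x : C a) :
  gcast (C := C) e' (gcast (C := C) e x) = x.
Proof. by subst b; rewrite !gcast_id. Qed.

(* The coproduct with a propositional equation for the degree, so that degrees
   need not match syntactically. *)
Definition comul a b c (e : c = (a * b)%g) (x : H c) : (H a \otimes H b)%type :=
  hDelta H a b (gcast (C := hcomp H) e x).

Fact linear_comul a b c (e : c = (a * b)%g) : linear (@comul a b c e).
Proof. by move=> k x y; rewrite /comul; subst c; rewrite /= linearP. Qed.

HB.instance Definition _ a b c (e : c = (a * b)%g) :=
  GRing.isLinear.Build K (H c) (H a \otimes H b)%type *:%R (comul e)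
    (linear_comul e).

Definition antipode a b (e : b = a^-1%g) (x : H a) : H b :=
  gcast (C := hcomp H) (esym e) (hS H a x).

Fact linear_antipode a b (e : b = a^-1%g) : linear (@antipode a b e).
Proof. by move=> k x y; rewrite /antipode; subst b; rewrite /= linearP. Qed.

HB.instance Definition _ a b (e : b = a^-1%g) :=
  GRing.isLinear.Build K (H a) (H b) *:%R (antipode e) (linear_antipode e).

Lemma comul_morphism a b c (e : c = (a * b)%g) : monoid_morphism (comul e).
Proof. by subst c; apply: hDelta_morphism. Qed.

Lemma comul_tassoc a b c ab bc abc (e1 : ab = (a * b)%g)
    (e2 : abc = (ab * c)%g) (e3 : bc = (b * c)%g) (e4 : abc = (a * bc)%g) x :
  tassoc (tmap (comul e1) idfun (comul e2 x)) =
  tmap idfun (comul e3) (comul e4 x).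
Proof.
subst ab bc abc; rewrite /comul (eq_irrelevance e4 (esym (mulgA a b c))).
exact: coassociative (hcoalgebra H) _ _ _ x.
Qed.

Lemma comul_coassoc a b c ab bc abc (e1 : ab = (a * b)%g)
    (e2 : abc = (ab * c)%g) (e3 : bc = (b * c)%g) (e4 : abc = (a * bc)%g)
    (U : lmodType K) (F : H a -> H b -> H c -> U) x :
  (forall q w, linear (fun p => F p q w)) ->
  (forall p w, linear (fun q => F p q w)) ->
  (forall p q, linear (F p q)) ->
  \sw_(u, w <- comul e2 x) \sw_(p, q <- comul e1 u) F p q w =
  \sw_(p, v <- comul e4 x) \sw_(q, w <- comul e3 v) F p q w.
Proof.
by move=> *; apply: tlift_coassoc => //; apply: comul_tassoc.
Qed.

Lemma comul_tevall a (e : a = (1 * a)%g) x : tevall (heps H) (comul e x) = x.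
Proof.
by rewrite /comul (counitl (hcoalgebra H)); exact: (gcastK (C := hcomp H)).
Qed.

Lemma comul_tevalr a (e : a = (a * 1)%g) x : tevalr (heps H) (comul e x) = x.
Proof.
by rewrite /comul (counitr (hcoalgebra H)); exact: (gcastK (C := hcomp H)).
Qed.

Lemma comul_counitr (U : lmodType K) a (e : a = (a * 1)%g) (f : H a -> U) x :
  linear f -> \sw_(u, v <- comul e x) (heps H v *: f u) = f x.
Proof.
move=> lf; rewrite -{2}(comul_tevalr e x) tlift_app //.
by apply: eq_tlift => u v; rewrite (scalable_linear lf).
Qed.

Lemma comul_antipodel a b (e : 1%g = (b * a)%g) (e' : a = b^-1%g) x :
  tlift (fun (u : H b) (v : H a) => antipode e' u * v) (comul e x) =
  heps H x *: (1 : H a).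
Proof.
have E : b = a^-1%g by rewrite e' invgK.
subst b.
have := @hantipodel _ _ H a (gcast (C := hcomp H) e x).
rewrite tmultE /antipode (eq_irrelevance (esym e') (invgK a)) => ->.
by rewrite (gcastK (C := hcomp H)).
Qed.

Lemma comul_antipoder a b (e : 1%g = (a * b)%g) (e' : a = b^-1%g) x :
  tlift (fun (u : H a) (v : H b) => u * antipode e' v) (comul e x) =
  heps H x *: (1 : H a).
Proof.
have E : b = a^-1%g by rewrite e' invgK.
subst b.
have := @hantipoder _ _ H a (gcast (C := hcomp H) e x).
rewrite tmultE /antipode (eq_irrelevance (esym e') (invgK a)) => ->.
by rewrite (gcastK (C := hcomp H)).
Qed.

(** The right side is x_1 \ox S(x_2) x_3, bracketed so that it depends on x only through its
    coproduct in degrees a, b. Hence that coproduct is injective when H_b is nonzero. *)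
Lemma tens1_recover a b c (e : c = (a * b)%g) (e' : a = (c * b^-1)%g) x :
  x \ox (1 : H b) =
  \sw_(z, w <- comul e x) tlift (fun (p : H c) (q : H b^-1%g) =>
    p \ox (antipode (esym (invgK b)) q * w)) (comul e' z).
Proof.
rewrite (comul_coassoc e' e (esym (mulVg b)) (esym (mulg1 c))
  (F := fun p q w => p \ox (antipode (esym (invgK b)) q * w)));
  try by move=> *; lin.
rewrite -(comul_counitr (esym (mulg1 c)) (f := fun x => x \ox (1 : H b)));
  last by lin.
apply: eq_tlift => p t.
rewrite -(tlift_app (h := fun y => p \ox y)); last by lin.
by rewrite comul_antipodel linearZr_LR.
Qed.

Lemma tens_inj (V W : vectType K) (v : V) (w : W) :
  w != 0 -> v \ox w = 0 -> v = 0.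
Proof.
move=> nzw /(congr1 (tevalr (dual_vector w))).
by rewrite /tevalr tlift_tens ?linear0 ?dual_vectorE ?scale1r //; bilin.
Qed.

Lemma zero_component a (x : H a) : (1 : H a) = 0 -> x = 0.
Proof. by move=> one0; rewrite -[x]mulr1 one0 mulr0. Qed.

(** Settles the case of [extend_integral_right] in which 1_a = 0 gives no coefficient to compare
    while H_b is nonzero. *)
Lemma zero_component_mul a b (x : H (a * b)%g) :
  (1 : H a) = 0 -> (1 : H b) != 0 -> x = 0.
Proof.
move=> one0 /tens_inj; apply; rewrite (tens1_recover erefl (esym (mulgK b a))).
by apply: tlift_eq0 => z w; rewrite (zero_component z one0) !linear0.
Qed.

(** Since D(1) = 1 \ox 1, [tens1_recover] in degrees 1 and a reads u \ox 1_a = 1_a \ox S(1) u; a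
    form with value 1 at 1_a, applied to the second leg, isolates u. *)
Lemma coinvariant_scalar a (u : H a) :
  comul (esym (mul1g a)) u = (1 : H 1%g) \ox u -> exists k, u = k *: (1 : H a).
Proof.
move=> uP; have [one0|nz] := eqVneq (1 : H a) 0.
  by exists 0; rewrite scale0r; apply: zero_component.
have := tens1_recover (esym (mul1g a)) (esym (mulgV a)) u.
rewrite uP tlift_tens; last by bilin.
rewrite (comul_morphism _).1 tlift_tens; last by bilin.
move/(congr1 (tevalr (dual_vector (1 : H a)))).
rewrite /tevalr !tlift_tens; try by bilin.
by rewrite dual_vectorE // scale1r => ->; eexists.
Qed.

Lemma one_neq0 : (1 : H 1%g) != 0.
Proof.
apply/eqP => /(congr1 (heps H)); rewrite (heps_morphism H).1 linear0.
by move/eqP; rewrite oner_eq0.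
Qed.

Lemma integral1_exists : exists mu : {scalar H 1%g},
  right_integral (comul (esym (mulg1 1%g))) mu /\ exists x, mu x != 0.
Proof.
(* The antipode of H_1 lands in degree 1^-1; [e] brings it back to degree 1. *)
have e : 1%g = 1^-1%g :> pi by rewrite invg1.
apply: (right_integral_exists (eps := heps H) (S := antipode e)) => //.
- exact: comul_tassoc.
- exact: comul_tevall.
- exact: comul_tevalr.
- exact: comul_morphism.
- exact: heps_morphism.
- exact: comul_antipodel.
- exact: comul_antipoder.
Qed.

Lemma integral1_unique (lam mu : {scalar H 1%g}) :
  right_integral (comul (esym (mulg1 1%g))) lam -> (exists x, lam x != 0) ->
  right_integral (comul (esym (mulg1 1%g))) mu ->
  exists k, forall x, mu x = k * lam x.
Proof.
have e : 1%g = 1^-1%g :> pi by rewrite invg1.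
move=> lamP nz muP.
apply: (right_integral_unique (eps := heps H) (S := antipode e)
  (D := comul (esym (mulg1 1%g)))) => //.
- exact: comul_tassoc.
- exact: comul_tevall.
- exact: comul_tevalr.
- exact: comul_morphism.
- exact: heps_morphism.
- exact: comul_antipodel.
- exact: comul_antipoder.
Qed.

Lemma comulZ a b c (e : c = (a * b)%g) k x :
  comul e (k *: x) = \sw_(p, q <- comul e x) ((k *: p) \ox q).
Proof.
rewrite linearZ /= [in LHS](tensE (comul e x)) [LHS]tlift_scaler.
by apply: eq_tlift => p q; rewrite linearZl_LR.
Qed.

(** * Extending an integral of H_1 to all degrees *)

Section Extension.
Variable mu : {scalar H 1%g}.
Hypothesis muP : right_integral (comul (esym (mulg1 1%g))) mu.

(** The coefficient of mu(x_1) x_2 along 1_a, made total: it is 0 on a zero component. *)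
Definition extend_integral a (x : H a) : K :=
  dual_vector (1 : H a) (tevall mu (comul (esym (mul1g a)) x)).

Fact scalar_extend_integral a : scalar (@extend_integral a).
Proof. by move=> k x y; rewrite /extend_integral /tevall !linearP. Qed.

HB.instance Definition _ a :=
  GRing.isLinear.Build K (H a) K *%R (@extend_integral a)
    (@scalar_extend_integral a).

(** The integral property of mu turns mu(x_1) x_2 \ox x_3 into 1 \ox mu(x_1) x_2, so [w] is
    coinvariant. *)
Lemma extend_integralE a x :
  tevall mu (comul (esym (mul1g a)) x) = extend_integral x *: (1 : H a).
Proof.
rewrite /extend_integral; set w := tevall _ _.
have [one0|nz] := eqVneq (1 : H a) 0.
  by rewrite one0 scaler0; apply: zero_component.
suff /coinvariant_scalar[k ->] : comul (esym (mul1g a)) w = (1 : H 1%g) \ox w.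
  by rewrite linearZ /= dual_vectorE // mulr1.
pose F (u : H 1%g) (p : H 1%g) (q : H a) := (mu u *: p) \ox q.
transitivity (\sw_(u, v <- comul (esym (mul1g a)) x)
    \sw_(p, q <- comul (esym (mul1g a)) v) F u p q).
  rewrite /w /tevall tlift_app; last exact: linearP.
  by apply: eq_tlift => u v; rewrite comulZ.
rewrite -(comul_coassoc (esym (mulg1 1%g)) (esym (mul1g a)));
  try by rewrite /F => *; lin.
rewrite /w /tevall (tlift_app (h := fun y => (1 : H 1%g) \ox y)); last by lin.
apply: eq_tlift => z q.
rewrite -(tlift_app (h := fun p => p \ox q)); last by lin.
by rewrite muP linearZl_LR linearZr_LR.
Qed.

Lemma extend_integral1 x : @extend_integral 1%g x = mu x.
Proof.
rewrite /extend_integral (eq_irrelevance (esym (mul1g 1%g)) (esym (mulg1 1%g))).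
by rewrite [tevall _ _]muP linearZ /= dual_vectorE ?mulr1 ?one_neq0.
Qed.

Lemma extend_integral_right : right_pi_integral (fun a => @extend_integral a).
Proof.
move=> a b x; have [one0|nzb] := eqVneq (1 : H b) 0.
  by rewrite one0 scaler0; apply: zero_component.
have [one0|nza] := eqVneq (1 : H a) 0.
  by rewrite (zero_component_mul x one0 nzb) /tevall !linear0 scale0r.
(* Compare after tensoring with 1_a on the left, which a form of value 1 at 1_a undoes. The element
   mu(x_1) x_2 \ox x_3 is 1_a \ox lambda_a(x_1) x_2, and it is also the coproduct of mu(x_1) x_2 =
   lambda_(ab)(x) 1. *)
rewrite -[LHS]scale1r -(dual_vectorE nza).
set y := tevall _ _.
transitivity (tevall (dual_vector (1 : H a)) ((1 : H a) \ox y)).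
  by rewrite /tevall tlift_tens //; bilin.
rewrite -[X in _ = X *: _]mulr1 -(dual_vectorE nza) -scalerA.
transitivity (tevall (dual_vector (1 : H a))
    (@extend_integral (a * b)%g x *: ((1 : H a) \ox (1 : H b)))); last first.
  by rewrite /tevall linearZ /= tlift_tens //; bilin.
congr tevall.
pose F (u : H 1%g) (p : H a) (q : H b) := (mu u *: p) \ox q.
transitivity (\sw_(z, q <- comul (erefl (a * b)%g) x)
    \sw_(u, p <- comul (esym (mul1g a)) z) F u p q).
  rewrite /y /tevall (tlift_app (h := fun y => (1 : H a) \ox y)); last by lin.
  apply: eq_tlift => z q.
  rewrite /F -(tlift_app (h := fun p => p \ox q)); last by lin.
  by rewrite [tlift _ _]extend_integralE linearZl_LR linearZr_LR.
rewrite (comul_coassoc _ _ (erefl (a * b)%g) (esym (mul1g (a * b)%g)));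
  try by rewrite /F => *; lin.
have one1 : (1 : H a) \ox (1 : H b) = comul (erefl (a * b)%g) 1.
  by rewrite (comul_morphism _).1.
rewrite one1; transitivity (comul (erefl (a * b)%g)
  (@extend_integral (a * b)%g x *: (1 : H (a * b)%g))); last by rewrite linearZ.
rewrite -extend_integralE /tevall tlift_app; last exact: linearP.
by apply: eq_tlift => u v; rewrite comulZ.
Qed.

End Extension.

(** * Right pi-integrals up to scalars *)

Lemma right_pi_integralE (lam : forall a, {scalar H a}) :
  right_pi_integral lam -> forall a b c (e : c = (a * b)%g) x,
  \sw_(u, v <- comul e x) (lam a u *: v) = lam c x *: (1 : H b).
Proof. by move=> lamP a b c e x; subst c; apply: lamP. Qed.

Lemma right_pi_integral_exists : exists2 lam : forall a, {scalar H a},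
  right_pi_integral lam & exists x, lam 1%g x = 1.
Proof.
have [mu [muP [x nz]]] := integral1_exists.
exists (fun a => @extend_integral mu a); first exact: extend_integral_right.
exists ((mu x)^-1 *: x).
by rewrite [LHS]extend_integral1 // linearZ /= mulVf.
Qed.

Lemma right_pi_integral_unique (lam mu : forall a, {scalar H a}) :
  right_pi_integral lam -> (exists x, lam 1%g x = 1) -> right_pi_integral mu ->
  exists k, forall a x, mu a x = k * lam a x.
Proof.
move=> lamP [x0 lam1] muP.
have [||| k kP] := @integral1_unique (lam 1%g) (mu 1%g).
- exact: right_pi_integralE.
- by exists x0; rewrite lam1 oner_eq0.
- exact: right_pi_integralE.
exists k => a x; have [one0|nz] := eqVneq (1 : H a) 0.
  by rewrite (zero_component x one0) !linear0 mulr0.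
have /(congr1 (dual_vector (1 : H a))) :=
  right_pi_integralE muP (esym (mul1g a)) x.
rewrite linearZ /= dual_vectorE // mulr1 => <-.
transitivity (dual_vector (1 : H a) ((k * lam a x) *: (1 : H a))); last first.
  by rewrite linearZ /= dual_vectorE // mulr1.
congr dual_vector; rewrite -scalerA -(right_pi_integralE lamP (esym (mul1g a))).
by rewrite tlift_scaler; apply: eq_tlift => u v; rewrite kP scalerA.
Qed.

(** * The distinguished grouplike element *)

Section Grouplike.
Variables (lam : forall a, {scalar H a}) (x0 : H 1%g).
Hypotheses (lamP : right_pi_integral lam) (lam1 : lam 1%g x0 = 1).

(* Since lam_1 x0 = 1, the value at x0 is the coefficient of
   x |-> x_1 lam(x_2) along lam_1. *)
Definition distinguished a : H a :=
  tevalr (lam a^-1%g) (comul (esym (mulgV a)) x0).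

Lemma distinguishedE a b c (e : c = (a * b)%g) x :
  \sw_(u, v <- comul e x) (lam b v *: u) = lam c x *: distinguished a.
Proof.
have [one0|nz] := eqVneq (1 : H c) 0.
  by rewrite (zero_component x one0) !linear0 scale0r.
apply: scalar_ext => f.
(* The integral equation of the family f(y_1) lam(y_2), in degrees 1 and d. At d = 1 it makes [phi]
   an integral of H_1, hence k times lam_1; at d = c it carries the same k to degree c. *)
have mE d d' (ed : d = (a * d')%g) y :
    \sw_(z, w <- comul (esym (mul1g d)) y)
      (f (tevalr (lam a^-1%g) (comul (esym (mulgV a)) z)) *: w) =
    f (tevalr (lam d') (comul ed y)) *: (1 : H d).
  pose F (u : H a) (v : H a^-1%g) (w : H d) := lam a^-1%g v *: (f u *: w).
  have ed' : d' = (a^-1 * d)%g by rewrite ed mulKg.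
  transitivity (\sw_(z, w <- comul (esym (mul1g d)) y)
      \sw_(u, v <- comul (esym (mulgV a)) z) F u v w).
    apply: eq_tlift => z w.
    rewrite (tlift_app (h := fun u => f u *: w)); last by lin.
    by apply: eq_tlift => u v; rewrite /F linearZ scalerA.
  rewrite (comul_coassoc _ _ ed' ed); try by rewrite /F => *; lin.
  rewrite (tlift_app (h := fun u => f u *: (1 : H d))); last by lin.
  apply: eq_tlift => u t.
  transitivity (f u *: \sw_(v, w <- comul ed' t) (lam a^-1%g v *: w)).
    by rewrite tlift_scaler; apply: eq_tlift => v w; rewrite /F !scalerA mulrC.
  by rewrite right_pi_integralE // [f (_ *: _)]linearZ /= !scalerA mulrC.
pose phi y := f (tevalr (lam a^-1%g) (comul (esym (mulgV a)) y)).
have lphi : scalar phi by rewrite /phi /tevalr; lin.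
pose hm := GRing.isLinear.Build K (H 1%g) K *%R phi lphi.
pose m : {scalar H 1%g} := HB.pack phi hm.
have [||| k kP] := @integral1_unique (lam 1%g) m.
- exact: right_pi_integralE.
- by exists x0; rewrite lam1 oner_eq0.
- move=> y; rewrite -(eq_irrelevance (esym (mul1g 1%g)) (esym (mulg1 1%g))).
  exact: mE.
have kE : f (distinguished a) = k by rewrite -[LHS]/(m x0) kP lam1 mulr1.
have := mE c b e x.
rewrite (eq_tlift (g := fun z w => k *: (lam 1%g z *: w)));
  last by move=> z w; rewrite -[f _]/(m z) kP scalerA.
rewrite -tlift_scaler right_pi_integralE // scalerA.
move/(congr1 (dual_vector (1 : H c))).
by rewrite !linearZ /= dual_vectorE // !mulr1 kE => <-; rewrite mulrC.
Qed.

Lemma distinguished_grouplike : pi_grouplike distinguished.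
Proof.
split=> [a b|].
  (* Split x0 in degrees a, b and (ab)^-1: by [distinguishedE], first the last two legs produce g_b,
     then the remaining two produce g_a. *)
  pose F (p : H a) (q : H b) (v : H (a * b)^-1%g) :=
    p \ox (lam (a * b)^-1%g v *: q).
  have eb : a^-1%g = (b * (a * b)^-1)%g by rewrite invgM mulgA mulgV mul1g.
  transitivity (\sw_(u, v <- comul (esym (mulgV (a * b)%g)) x0)
      \sw_(p, q <- comul (erefl (a * b)%g) u) F p q v).
    rewrite -[LHS]/(comul (erefl _) _) /distinguished /tevalr.
    rewrite tlift_app; last exact: linearP.
    apply: eq_tlift => u v; rewrite comulZ; apply: eq_tlift => p q.
    by rewrite linearZl_LR -linearZr_LR.
  rewrite (comul_coassoc _ _ eb (esym (mulgV a))); try by rewrite /F => *; lin.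
  transitivity ((\sw_(p, t <- comul (esym (mulgV a)) x0)
      (lam a^-1%g t *: p)) \ox distinguished b); last first.
    by rewrite distinguishedE lam1 scale1r.
  rewrite (tlift_app (h := fun p => p \ox distinguished b)); last by lin.
  apply: eq_tlift => p t.
  rewrite -(tlift_app (h := fun q => p \ox q)); last by lin.
  by rewrite distinguishedE linearZl_LR linearZr_LR.
(* This writes g_1 as u lam_1(v) over the coproduct of x0; applying eps leaves lam_1(x0) = 1. *)
have := distinguishedE (esym (mulg1 1%g)) x0.
rewrite lam1 scale1r => <-.
transitivity (tlift (fun u v : H 1%g => heps H u *: (lam 1%g v : K^o))
    (comul (esym (mul1g 1%g)) x0)).
  rewrite tlift_appK; last exact: linearP.
  rewrite (eq_irrelevance (esym (mulg1 1%g)) (esym (mul1g 1%g))).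
  by apply: (@eq_tlift _ _ _ K^o) => u v; rewrite linearZ /= mulrC.
rewrite -lam1 -[x0 in RHS](comul_tevall (esym (mul1g 1%g))).
rewrite /tevall tlift_appK; last exact: linearP.
by apply: (@eq_tlift _ _ _ K^o) => u v; rewrite linearZ.
Qed.

End Grouplike.

End Graded.

Theorem lemma8 (pi : groupType) (K : fieldType) (H : hopf_pi_coalgebra pi K) :
  exists! g : forall a : pi, H a,
    pi_grouplike g /\
    forall lambda : forall a : pi, {scalar H a},
      right_pi_integral lambda ->
      forall (a b : pi) (x : H (a * b)%g),
        tevalr (lambda b) (hDelta H a b x) = lambda (a * b)%g x *: g a.
Proof.
have [lam lamP [x0 lam1]] := right_pi_integral_exists H.
have gP := distinguishedE lamP lam1.
exists (distinguished lam x0); split.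
  split; first exact: distinguished_grouplike.
  move=> mu muP a b x.
  have [|k kP] := right_pi_integral_unique lamP _ muP; first by exists x0.
  rewrite kP -scalerA -(gP _ _ _ (erefl (a * b)%g)) tlift_scaler.
  by apply: eq_tlift => u v; rewrite kP scalerA.
move=> g [_ gE]; apply: functional_extensionality_dep => a.
(* Transported to degree a a^-1, x0 still has integral 1, so the equation for g there, with b =
   a^-1, gives g_a. *)
have := gE lam lamP a a^-1%g (gcast (C := hcomp H) (esym (mulgV a)) x0).
rewrite -[tevalr _ _]/(distinguished lam x0 a) => ->.
suff -> : lam (a * a^-1)%g (gcast (C := hcomp H) (esym (mulgV a)) x0) = 1.
  by rewrite scale1r.
by rewrite -lam1; case: _ / (esym (mulgV a)).
Qed.
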